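(* Let $I$ be an arbitrary (possibly infinite, possibly uncountable) index set. (a) Let $\mu\in\mathcal P(\bar{\mathbb R}^I)$ be a probability measure with one-dimensional marginals $\mu_i$, $i\in I$. Then there exists a copula measure $C\in\mathcal C(\bar{\mathbb R}^I)$ such that for every finite $J\subseteq I$ and every $(x_j)_{j\in J}\in\bar{\mathbb R}^J$, $$F_{C_J}\big((F_{\mu_j}(x_j))_{j\in J}\big)=F_{\mu_J}\big((x_j)_{j\in J}\big). \qquad (\ast)$$ Moreover, $C$ is unique if $F_{\mu_i}$ is continuous for each $i\in I$. (b) Conversely, let $C\in\mathcal C(\bar{\mathbb R}^I)$ be a copula measure and let $(\mu_i)_{i\in I}$ be a family of Borel probability measures on $\bar{\mathbb R}$. Then there exists a unique probability measure $\mu\in\mathcal P(\bar{\mathbb R}^I)$ such that $(\ast)$ holds for every finite $J\subseteq I$ and every $(x_j)_{j\in J}\in\bar{\mathbb R}^J$.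
   Context: $\bar{\mathbb R}=[-\infty,\infty]$ with its Borel $\sigma$-algebra $\mathcal B(\bar{\mathbb R})$. For an index set $I$, $\mathcal P(\bar{\mathbb R}^I)$ denotes the set of probability measures on $(\bar{\mathbb R}^I,\otimes_{i\in I}\mathcal B(\bar{\mathbb R}))$ (product $\sigma$-algebra). For $J\subseteq I$, $\pi_J:\bar{\mathbb R}^I\to\bar{\mathbb R}^J$ is the canonical projection and $\mu_J:=(\pi_J)_*\mu=\mu\circ\pi_J^{-1}$; for $i\in I$, $\mu_i:=\mu_{\{i\}}$ (the marginals). For finite $J$, the cumulative distribution function of a probability measure $\nu$ on $\bar{\mathbb R}^J$ is $F_\nu((x_j)_{j\in J})=\nu(\prod_{j\in J}[-\infty,x_j])$ for $(x_j)\in\bar{\mathbb R}^J$; in particular for a probability measure $\nu$ on $\bar{\mathbb R}$, $F_\nu(x)=\nu([-\infty,x])$. A copula measure on $\bar{\mathbb R}^I$ is a $C\in\mathcal P(\bar{\mathbb R}^I)$ whose every one-dimensional marginal $C_i$, $i\in I$, is the uniform distribution on $[0,1]$; $\mathcal C(\bar{\mathbb R}^I)$ denotes the set of copula measures on $\bar{\mathbb R}^I$.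
   Formalization: Uniqueness of C in (a) is stated with the added condition that each F_{μ_i}(−∞)=0 besides continuity; without it the claim fails, e.g. for μ the point mass at (−∞,…,−∞) with at least two indices, where every copula satisfies (∗). *)

(* Defs.v *)
From HB Require Import structures.
From mathcomp Require Import all_boot all_order all_algebra.
From mathcomp Require Import all_classical all_reals all_analysis measurable_realfun lebesgue_measure probability.
Set Implicit Arguments. Unset Strict Implicit. Unset Printing Implicit Defensive.
Import Order.TTheory GRing.Theory Num.Theory.
Local Open Scope classical_set_scope.
Local Open Scope ring_scope.
Local Open Scope ereal_scope.

Definition prod_gen (I : Type) (R : realType) : set (set (I -> \bar R)) :=
  \bigcup_(i in [set: I])
    preimage_set_system [set: I -> \bar R] (fun f => f i)
      (@measurable _ (\bar R)).

Definition eRprod (I : Type) (R : realType) := g_sigma_algebraType (@prod_gen I R).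
Arguments eRprod : clear implicits.

(* F_{mu_J}((x_j)_{j in J}) = mu(prod_{j in J} [-oo, x_j] x \bar R^{I\J}),
   with the point (x_j)_{j in J} given by a function x : I -> \bar R
   (only its values on J matter). *)
Definition cdfJ (I : Type) (R : realType) (mu : set (eRprod I R) -> \bar R)
  (J : set I) (x : I -> \bar R) : \bar R :=
  mu [set f : eRprod I R | forall j, J j -> f j <= x j].

Definition cdf1 (I : Type) (R : realType) (mu : set (eRprod I R) -> \bar R)
  (i : I) (x : \bar R) : \bar R :=
  mu [set f : eRprod I R | f i <= x].

Definition cdfR (R : realType) (nu : set (\bar R) -> \bar R) (x : \bar R) : \bar R :=
  nu `[-oo, x]%classic.

Definition unif01 (R : realType) (A : set (\bar R)) : \bar R :=
  (@lebesgue_measure R) ([set r : R | A r%:E] `&` `[0%R, 1%R]%classic).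

Definition is_copula (I : Type) (R : realType) (C : probability (eRprod I R) R) :=
  forall (i : I) (A : set (\bar R)), measurable A ->
    C [set u : eRprod I R | A (u i)] = unif01 A.

(* Main.v *)
Require Import Defs.
From HB Require Import structures.
From mathcomp Require Import all_boot all_order all_algebra.
From mathcomp Require Import lra.
From mathcomp Require Import all_classical all_reals all_analysis measurable_realfun lebesgue_measure probability.
Set Implicit Arguments. Unset Strict Implicit. Unset Printing Implicit Defensive.
Import Order.TTheory GRing.Theory Num.Theory.
Local Open Scope classical_set_scope.
Local Open Scope ring_scope.
Local Open Scope ereal_scope.

(** With a single variable [V] uniform on [0,1] and independent of
    [X = (X_i)], the randomised distribution functions
    [U_i = F_i(X_i-) + V (F_i(X_i) - F_i(X_i-))] are all uniform, so the joint
    law of [U] is a copula: no projective limit is needed, however large [I].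
    Since [X_j <= x_j] implies [U_j <= F_j(x_j)] and both events have
    probability [F_j(x_j)], they agree up to a null set, which gives
    Sklar's identity over any finite [J].  Conversely, a copula is pushed
    forward coordinatewise by the quantile functions.  Both uniqueness claims follow from the pi-system
    of cylinders; for copulas, continuity makes each [F_i] onto [0,1]. *)

(** * Finite intersections of events that agree up to null sets *)

(** The difference of the two intersections is covered by finitely many null sets, the differences
    of [A j] and [B j]. *)
Lemma le_measure_bigcap d (T : measurableType d) (R : realType)
    (P : probability T R) (I : Type) (J : set I) (A B : I -> set T) :
  finite_set J ->
  (forall j, J j -> measurable (A j)) -> (forall j, J j -> measurable (B j)) ->
  (forall j, J j -> P (A j `\` B j) = 0) ->
  P (\bigcap_(j in J) A j) <= P (\bigcap_(j in J) B j).
Proof.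
move=> fJ mA mB AB0.
have mcA := fin_bigcap_measurable fJ mA.
have mcB := fin_bigcap_measurable fJ mB.
have mAB j : J j -> measurable (A j `\` B j).
  by move=> Jj; apply: measurableD; [exact: mA|exact: mB].
suff D0 : P (\bigcap_(j in J) A j `\` \bigcap_(j in J) B j) = 0.
  rewrite (measureDI P mcA mcB) [X in X + _]D0 add0e.
  by apply: le_measure; rewrite ?inE//; exact: measurableI.
apply/eqP; rewrite eq_le measure_ge0 andbT.
(* [I] is a bare type; [{classic I}] gives it the choice structure that the finite sum requires. *)
have : P (\bigcap_(j in J) A j `\` \bigcap_(j in J) B j) <=
    \sum_(j \in (J : set {classic I})) P (A j `\` B j).
  apply: content_sub_fsum => //; first exact: measurableD.
  move=> t [At /existsNP[j /not_implyP[Jj nBj]]].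
  by exists j => //; split => //; exact: At.
by rewrite fsbig1// => j Jj; exact: AB0.
Qed.

(** Nested events of equal finite probability differ by a null set, so each [A j] may be exchanged
    for [B j]. The direction of the inclusion may vary with [j]. *)
Lemma measure_nested_bigcap d (T : measurableType d) (R : realType)
    (P : probability T R) (I : Type) (J : set I) (A B : I -> set T) :
  finite_set J ->
  (forall j, J j -> measurable (A j)) -> (forall j, J j -> measurable (B j)) ->
  (forall j, J j -> A j `<=` B j \/ B j `<=` A j) ->
  (forall j, J j -> P (A j) = P (B j)) ->
  P (\bigcap_(j in J) A j) = P (\bigcap_(j in J) B j).
Proof.
move=> fJ mA mB nest PAB.
have D0 S S' : measurable S -> measurable S' -> S `<=` S' \/ S' `<=` S ->
    P S = P S' -> P (S `\` S') = 0.
  move=> mS mS' [SS'|S'S] PE.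
    by rewrite (_ : S `\` S' = set0) ?measure0// setD_eq0.
  have PS'fin : P S' \is a fin_num by exact: fin_num_measure.
  have PSoo : P S < +oo by rewrite PE ltey_eq PS'fin.
  have -> : P (S `\` S') = P S - P S'.
    by rewrite -[in RHS](setIidr S'S); exact: measureD.
  by rewrite PE subee.
apply/eqP; rewrite eq_le; apply/andP; split.
  apply: le_measure_bigcap => // j Jj.
  exact: D0 (mA _ Jj) (mB _ Jj) (nest _ Jj) (PAB _ Jj).
apply: le_measure_bigcap => // j Jj.
apply: D0 (mB _ Jj) (mA _ Jj) _ (esym (PAB _ Jj)).
by case: (nest _ Jj); [right|left].
Qed.

(** * One-sided limits on the extended line *)

(** Serves to write [X < q] as a countable increasing union of events [X < y n]. *)
Lemma ereal_lt_seq (R : realType) (q : \bar R) : q != -oo ->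
  exists y : nat -> \bar R, [/\ {homo y : m n / (m <= n)%N >-> m <= n},
    forall n, y n < q & forall x, x < q -> exists n, x < y n].
Proof.
case: q => [r _|_|//].
  exists (fun n => (r - n.+1%:R^-1)%:E); split.
  - move=> m n mn; rewrite lee_fin lerD2l lerN2 lef_pV2 ?posrE// ?ltr0n//.
    by rewrite ler_nat.
  - by move=> n; rewrite lte_fin ltrBlDr ltrDl invr_gt0.
  - move=> [x| |] //=; last by exists 0%N; rewrite ltNyr.
    rewrite lte_fin -subr_gt0 => xr.
    have [n _ /(_ _ (leqnn n))] := near_infty_natSinv_lt (PosNum xr).
    by move=> /= h; exists n; rewrite lte_fin ltrBrDl -ltrBrDr.
exists (fun n => n%:R%:E); split.
- by move=> m n mn; rewrite lee_fin ler_nat.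
- by move=> n; rewrite ltry.
- move=> [x _| |_] //; last by exists 0%N; rewrite ltNyr.
  exists (Num.bound `|x|); rewrite lte_fin.
  exact: le_lt_trans (ler_norm _) (archi_boundP (normr_ge0 _)).
Qed.

(** For use at a quantile: a condition holding near it then holds at some strictly smaller point,
    against minimality. *)
Lemma nbhs_ereal_lt (R : realType) (y : \bar R) (S : set (\bar R)) :
  y != -oo -> nbhs y S -> exists2 z, z < y & S z.
Proof.
case: y => [r _ nS|_|//].
  have /nbhs_ballP[e /= e0 reS] : nbhs (r : R^o) (fun s : R^o => S s%:E) by [].
  exists (r - e / 2)%:E.
    by rewrite lte_fin ltrBlDr ltrDl divr_gt0.
  apply: reS; rewrite -ball_normE/= opprB addrC subrK gtr0_norm ?divr_gt0//.
  by rewrite ltr_pdivrMr// ltr_pMr// ltr1n.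
move=> [M [_ MS]]; exists (M + 1)%:E; first exact: ltry.
by apply: MS; rewrite lte_fin ltrDl.
Qed.

(** Continuity of [P] from below. At [q = -oo] the hypothesis on [y] is vacuous and [0 <= u] gives
    the bound. *)
Lemma probability_lt_lim d (T : measurableType d) (R : realType)
    (P : probability T R) (X : T -> \bar R) (q u : \bar R) :
  measurable_fun setT X -> 0 <= u ->
  (forall y, y < q -> P [set t | X t < y] <= u) -> P [set t | X t < q] <= u.
Proof.
move=> mX u0 Pu.
have [->|qNy] := eqVneq q -oo.
  rewrite (_ : [set _ | _] = set0) ?measure0//.
  by rewrite -subset0 => t /=; rewrite ltNge leNye.
have [y [y_nd yq yS]] := ereal_lt_seq qNy.
have mF n : measurable [set t | X t < y n].
  by rewrite -[X in measurable X]setTI; exact: emeasurable_fun_infty_o.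
have -> : [set t | X t < q] = \bigcup_n [set t | X t < y n].
  apply/seteqP; split=> t /=; first by move=> /yS[n tn]; exists n.
  by move=> [n _ /= tn]; exact: lt_trans tn (yq n).
have /cvg_lim <- // : P \o (fun n => [set t | X t < y n]) @ \oo -->
    P (\bigcup_n [set t | X t < y n]).
  apply: nondecreasing_cvg_mu => //; first exact: bigcupT_measurable.
  move=> m n mn; apply/subsetPset => t /= tm; apply: (lt_le_trans tm).
  exact: y_nd.
apply: lime_le; last by apply: nearW => n; exact: Pu.
apply: ereal_nondecreasing_is_cvgn => m n mn /=.
apply: le_measure; rewrite ?inE// => t /= tm.
by apply: (lt_le_trans tm); exact: y_nd.
Qed.

(** The previous lemma for [- X], [- q] and [1 - u], through complements; it amounts to right
    continuity of the distribution function. *)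
Lemma probability_le_lim d (T : measurableType d) (R : realType)
    (P : probability T R) (X : T -> \bar R) (q u : \bar R) :
  measurable_fun setT X -> u <= 1 ->
  (forall y, q < y -> u <= P [set t | X t <= y]) -> u <= P [set t | X t <= q].
Proof.
move=> mX u1 Pu.
have PC y : P [set t | - X t < - y] = 1 - P [set t | X t <= y].
  rewrite -probability_setC.
    by congr (P _); apply/seteqP; split=> t /=; rewrite lteN2 ltNge => /negP.
  by rewrite -[X in measurable X]setTI; exact: emeasurable_fun_infty_c.
have Pfin A : measurable A -> P A \is a fin_num by exact: fin_num_measure.
have mle y : measurable [set t | X t <= y].
  by rewrite -[X in measurable X]setTI; exact: emeasurable_fun_infty_c.
have [uN|uNN] := eqVneq u -oo; first by rewrite uN leNye.
have ufin : u \is a fin_num.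
  by rewrite fin_numE uNN/=; apply: contraTneq u1 => ->; rewrite -ltNge ltry.
suff : P [set t | - X t < - q] <= 1 - u.
  by rewrite PC -(fineK (Pfin _ (mle q))) -(fineK ufin) !lee_fin lerD2l lerN2.
apply: probability_lt_lim.
- exact: measurableT_comp.
- by rewrite sube_ge0// ufin orbT.
- move=> y yq; rewrite -[y]oppeK PC.
  by apply: leeB => //; apply: Pu; rewrite lteNr.
Qed.

(** * Borel sets of the extended line *)

Lemma ereal_measurable_rays (R : realType) :
  @measurable _ (\bar R) =
  <<s [set A | exists x, A = [set y : \bar R | y <= x]] >>.
Proof.
apply/seteqP; split => A.
  have -> : @measurable _ (\bar R) = <<s @ErealGenOInfty.G R >>.
    exact: ErealGenOInfty.measurableE.
  apply: smallest_sub; first exact: smallest_sigma_algebra.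
  move=> _ [r ->]; rewrite -setCitvl.
  apply: sigma_algebraC; apply: sub_sigma_algebra; exists r%:E.
  by apply/seteqP; split => y /=; rewrite in_itv.
apply: smallest_sub; first exact: sigma_algebra_measurable.
move=> _ [x ->]; rewrite (_ : [set _ | _] = `]-oo, x]%classic).
  exact: emeasurable_itv.
by apply/seteqP; split => y /=; rewrite in_itv.
Qed.

(** The preimage of an upper ray is upward closed, hence itself a ray starting at its infimum,
    closed or open according to whether it contains that infimum. *)
Lemma nondecreasing_emeasurable (R : realType) (f : \bar R -> \bar R) :
  {homo f : x y / x <= y} -> measurable_fun setT f.
Proof.
move=> f_nd; apply: (measurability _ (ErealGenCInfty.measurableE R)).
move=> _ [_ [r ->] <-]; rewrite setTI.
set S := _ @^-1` _.
have Sup x y : S x -> x <= y -> S y.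
  by rewrite /S /= !in_itv/= !andbT => rx xy; apply: le_trans rx (f_nd _ _ xy).
have [Sinf|Sinf] := pselect (S (ereal_inf S)).
  rewrite (_ : S = `[ereal_inf S, +oo[%classic); first exact: emeasurable_itv.
  apply/seteqP; split => y; rewrite /= in_itv/= andbT.
    exact: ereal_inf_lbound.
  exact: Sup.
rewrite (_ : S = `]ereal_inf S, +oo[%classic); first exact: emeasurable_itv.
apply/seteqP; split => y; rewrite [in X in _ -> X]/= [X in X -> _]/= in_itv/= andbT.
  move=> Sy; rewrite lt_neqAle ereal_inf_lbound// andbT.
  by apply/eqP => yE; apply: Sinf; rewrite yE.
by move=> /ereal_inf_lt[z Sz /ltW zy]; exact: Sup zy.
Qed.

(** * The product sigma-algebra and its pi-system of cylinders *)

Section Product.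
Variables (I : Type) (R : realType).

Lemma measurable_proj (i : I) :
  measurable_fun [set: eRprod I R] (fun f : eRprod I R => f i).
Proof.
move=> _ A mA; rewrite setTI; apply: sub_sigma_algebra.
by exists i => //; exists A => //; rewrite setTI.
Qed.

Lemma measurable_into_prod d (T : measurableType d) (g : T -> eRprod I R) :
  (forall i, measurable_fun setT (fun t => g t i)) -> measurable_fun setT g.
Proof.
have mE : @measurable _ (eRprod I R) = <<s @prod_gen I R >> by [].
move=> mg; apply: (measurability _ mE).
move=> _ [_ [i _ [A mA <-]] <-]; rewrite !setTI.
by have := mg i measurableT A mA; rewrite setTI.
Qed.

Definition cylinder (J : set I) (x : I -> \bar R) : set (eRprod I R) :=
  [set f | forall j, J j -> f j <= x j].

Lemma cylinderE J x : cylinder J x = \bigcap_(j in J) [set f | f j <= x j].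
Proof. by []. Qed.

Lemma measurable_coord_le (i : I) (x : \bar R) :
  measurable [set f : eRprod I R | f i <= x].
Proof.
rewrite -[X in measurable X]setTI; apply: emeasurable_fun_infty_c => //.
exact: measurable_proj.
Qed.

Let G : set (set (eRprod I R)) :=
  [set A | exists J x, finite_set J /\ A = cylinder J x].

(** The preimage of a ray under a coordinate is a cylinder over a singleton, and rays generate the
    Borel sets; so coordinates are measurable for the sigma-algebra generated by [G]. *)
Let measurable_prod_cylinders : @measurable _ (eRprod I R) = <<s G >>.
Proof.
apply/seteqP; split => A; last first.
  apply: smallest_sub; first exact: sigma_algebra_measurable.
  move=> _ [J [x [fJ ->]]]; rewrite cylinderE.
  by apply: fin_bigcap_measurable => // j _; exact: measurable_coord_le.
apply: smallest_sub; first exact: smallest_sigma_algebra.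
move=> _ [i _ [B mB <-]]; rewrite setTI.
have mproj : measurable_fun setT (fun f : g_sigma_algebraType G => f i).
  apply: (measurability _ (ereal_measurable_rays R)).
  move=> _ [_ [x ->] <-]; rewrite setTI; apply: sub_sigma_algebra.
  exists [set i], (fun=> x); split; first exact: finite_set1.
  by apply/seteqP; split => f /=; [move=> fx j ->|apply].
by have := mproj measurableT B mB; rewrite setTI.
Qed.

Lemma eq_cdfJ (mu1 mu2 : probability (eRprod I R) R) :
  (forall J x, finite_set J -> cdfJ mu1 J x = cdfJ mu2 J x) ->
  forall A, measurable A -> mu1 A = mu2 A.
Proof.
move=> mu12; apply: (measure_unique G (fun=> setT)) => //.
- move=> _ _ [J [x [fJ ->]]] [K [y [fK ->]]].
  (* The bound [+oo] at an index outside [J] or outside [K] imposes no constraint there. *)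
  exists (J `|` K), (fun j => mine (if `[< J j >] then x j else +oo)
                             (if `[< K j >] then y j else +oo)).
  split; first by rewrite finite_setU.
  apply/seteqP; split => f /=.
    move=> [fx fy] j _; rewrite le_min; apply/andP; split.
      by case: asboolP => [/fx//|_]; exact: leey.
    by case: asboolP => [/fy//|_]; exact: leey.
  move=> fxy; split => j Aj.
    have := fxy j (or_introl Aj).
    by rewrite le_min => /andP[+ _]; case: asboolP.
  have := fxy j (or_intror Aj).
  by rewrite le_min => /andP[_]; case: asboolP.
- move=> _; exists set0, (fun=> +oo); split => //.
  by apply/seteqP; split => // f _ j [].
- by rewrite bigcup_const//; exists 0%N.
- by move=> _ [J [x [fJ ->]]]; exact: mu12.
- by move=> _ /=; rewrite -ge0_fin_numE// fin_num_measure.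
Qed.

End Product.

Lemma probability_image d d' (T : measurableType d) (T' : measurableType d')
    (R : realType) (P : probability T R) (g : T -> T') :
  measurable_fun setT g ->
  exists Q : probability T' R, forall A, Q A = P (g @^-1` A).
Proof.
move=> mg; pose g' : {mfun T >-> T'} := mfun_Sub (mem_set mg).
by exists (distribution P g') => A.
Qed.

(** * The uniform law on [0,1] *)

Section Uniform.
Variable R : realType.

(** The distribution function of the uniform law on [0,1], over the whole extended line. *)
Definition clip01 (x : \bar R) : \bar R := maxe 0 (mine x 1).

Lemma clip01_itv x : 0 <= clip01 x <= 1.
Proof. by rewrite /clip01 le_max lexx/= ge_max ge_min lee01 lexx orbT. Qed.

Lemma clip01_id x : 0 <= x <= 1 -> clip01 x = x.
Proof.
by move=> /andP[x0 x1]; rewrite /clip01 (min_idPl x1) (max_idPr x0).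
Qed.

Lemma clip01_lt0 x : x < 0 -> clip01 x = 0.
Proof. by move=> x0; rewrite /clip01; apply/max_idPl; rewrite ge_min ltW. Qed.

Lemma clip01_gt1 x : 1 < x -> clip01 x = 1.
Proof.
by move=> x1; rewrite /clip01 (min_idPr (ltW x1)); apply/max_idPr/lee01.
Qed.

Lemma unif01_le (x : \bar R) : unif01 [set y : \bar R | y <= x] = clip01 x.
Proof.
rewrite /unif01.
have [x0|x0] := ltP x 0.
  rewrite clip01_lt0// (_ : _ `&` _ = set0) ?measure0//.
  apply/seteqP; split => // r /= [rx]; rewrite in_itv/= => /andP[r0 _].
  by move: (le_lt_trans rx x0); rewrite lte_fin ltNge r0.
have [x1|x1] := ltP 1 x.
  rewrite clip01_gt1// setIidr.
    rewrite /= lebesgue_measure_itv/= lte_fin ltr01.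
    by rewrite -EFinB subr0.
  move=> r /=; rewrite in_itv/= => /andP[_ r1].
  by apply: (le_trans _ (ltW x1)); rewrite lee_fin.
rewrite clip01_id ?x0//.
case: x x0 x1 => // r; rewrite !lee_fin => r0 r1.
rewrite (_ : _ `&` _ = `[0%R, r]%classic).
  rewrite lebesgue_measure_itv/= lte_fin -EFinB subr0.
  by case: ltP => // rle; congr EFin; apply/eqP; rewrite eq_le r0 rle.
apply/seteqP; split => s /=; rewrite lee_fin !in_itv/=.
  by move=> [sr /andP[-> _]].
by move=> /andP[-> sr]; split => //; rewrite (le_trans sr).
Qed.

Lemma unif01_unique d (T : measurableType d) (P : probability T R)
    (X : T -> \bar R) : measurable_fun setT X ->
  (forall x, P [set t | X t <= x] = clip01 x) ->
  forall A, measurable A -> P [set t | A (X t)] = unif01 A.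
Proof.
move=> mX PX A mA.
have [Q QE] := probability_image P mX.
have -> : P [set t | A (X t)] = Q A by rewrite QE.
(* [unif01] is the image under [EFin] of Lebesgue measure restricted to [0,1], hence a measure, and
   the pi-system of rays determines it. *)
pose lam := mrestr (@lebesgue_measure R) (measurable_itv `[0%R, 1%R]).
have -> : unif01 A = pushforward lam EFin A by [].
apply: (measure_unique [set A | exists x, A = [set y : \bar R | y <= x]]
                       (fun=> setT)) mA => //.
- exact: ereal_measurable_rays.
- move=> _ _ [x ->] [y ->]; exists (mine x y).
  by apply/seteqP; split => z /=; rewrite le_min => /andP.
- by move=> _; exists +oo; apply/seteqP; split => // z _ /=; rewrite leey.
- by rewrite bigcup_const//; exists 0%N.
- by move=> _ [x ->]; exact: etrans (QE _) (etrans (PX x) (esym (unif01_le x))).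
- by move=> _ /=; rewrite -ge0_fin_numE// fin_num_measure.
Qed.

End Uniform.

(** * Distribution functions and their generalised inverses *)

Section Quantile.
Context d (T : measurableType d) (R : realType).
Variables (P : probability T R) (X : T -> \bar R).
Hypothesis mX : measurable_fun setT X.

Definition cdf_of (y : \bar R) : \bar R := P [set t | X t <= y].
(** The left limit F(y-), expressed as a probability. *)
Definition lcdf_of (y : \bar R) : \bar R := P [set t | X t < y].
Definition quantile (u : \bar R) : \bar R :=
  ereal_inf [set y | u <= cdf_of y].

Lemma measurable_rv_le y : measurable [set t | X t <= y].
Proof. by rewrite -[X in measurable X]setTI; exact: emeasurable_fun_infty_c. Qed.

Lemma measurable_rv_lt y : measurable [set t | X t < y].
Proof. by rewrite -[X in measurable X]setTI; exact: emeasurable_fun_infty_o. Qed.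

Lemma cdf_of_itv y : 0 <= cdf_of y <= 1.
Proof. by rewrite measure_ge0/= probability_le1//; exact: measurable_rv_le. Qed.

Lemma cdf_of_fin y : cdf_of y \is a fin_num.
Proof. exact/fin_num_measure/measurable_rv_le. Qed.

Lemma lcdf_of_fin y : lcdf_of y \is a fin_num.
Proof. exact/fin_num_measure/measurable_rv_lt. Qed.

Lemma cdf_of_nd : {homo cdf_of : x y / x <= y}.
Proof.
move=> x y xy; apply: le_measure; rewrite ?inE; try exact: measurable_rv_le.
by move=> t /= /le_trans; exact.
Qed.

Lemma lcdf_of_nd : {homo lcdf_of : x y / x <= y}.
Proof.
move=> x y xy; apply: le_measure; rewrite ?inE; try exact: measurable_rv_lt.
by move=> t /= /lt_le_trans; exact.
Qed.

Lemma lcdf_of_le y : lcdf_of y <= cdf_of y.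
Proof.
apply: le_measure; rewrite ?inE;
  [exact: measurable_rv_lt|exact: measurable_rv_le|].
by move=> t /= /ltW.
Qed.

Lemma cdf_of_le_lcdf x y : x < y -> cdf_of x <= lcdf_of y.
Proof.
move=> xy; apply: le_measure; rewrite ?inE;
  [exact: measurable_rv_le|exact: measurable_rv_lt|].
by move=> t /= /le_lt_trans; exact.
Qed.

Lemma probability_rv_eq y : P [set t | X t = y] = cdf_of y - lcdf_of y.
Proof.
have mlt := measurable_rv_lt y.
have -> : [set t | X t = y] = [set t | X t <= y] `\` [set t | X t < y].
  apply/seteqP; split => t /=; first by move=> ->; rewrite lexx ltxx.
  by move=> [ty /negP]; rewrite -leNgt => yt; apply/eqP; rewrite eq_le ty yt.
have -> : lcdf_of y = P ([set t | X t <= y] `&` [set t | X t < y]).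
  by rewrite setIidr// => t /= /ltW.
apply: measureD => //; first exact: measurable_rv_le.
by rewrite -ge0_fin_numE//; exact: cdf_of_fin.
Qed.

Lemma quantile_le_of u y : u <= cdf_of y -> quantile u <= y.
Proof. by move=> uy; exact: ereal_inf_lbound. Qed.

(** Right continuity makes the infimum attained. For [u > 1] it is taken over the empty set, and the
    equivalence breaks at [y = +oo]. *)
Lemma quantile_le u y : u <= 1 -> (quantile u <= y) = (u <= cdf_of y).
Proof.
move=> u1; apply/idP/idP => [|/quantile_le_of//].
move=> /cdf_of_nd; apply: le_trans; apply: probability_le_lim => //.
move=> z /ereal_inf_lt[w /= uw /ltW wz].
exact: le_trans uw (cdf_of_nd wz).
Qed.

(** By minimality [cdf_of y < u] for every [y] below the quantile; the left limit inherits the weak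
    bound. *)
Lemma lcdf_quantile u : 0 <= u -> lcdf_of (quantile u) <= u.
Proof.
move=> u0; apply: probability_lt_lim => // y yq.
apply: le_trans (lcdf_of_le y) _; rewrite leNgt; apply/negP => /ltW.
by move/quantile_le_of; rewrite leNgt yq.
Qed.

Lemma quantile_nd : {homo quantile : u v / u <= v}.
Proof.
move=> u v uv; apply: le_ereal_inf_tmp => y /= vy.
exact/quantile_le_of/(le_trans uv).
Qed.

Lemma measurable_quantile : measurable_fun setT quantile.
Proof. exact/nondecreasing_emeasurable/quantile_nd. Qed.

(** If F exceeded [u] at the quantile, by continuity it would do so at a smaller point too. Where
    the quantile is [-oo] no smaller point exists, and [cdf_of -oo = 0] concludes. *)
Lemma cdf_quantile u : continuous cdf_of -> cdf_of -oo = 0 ->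
  0 <= u <= 1 -> cdf_of (quantile u) = u.
Proof.
move=> cF F0 /andP[u0 u1]; apply/eqP; rewrite eq_le -quantile_le// lexx andbT.
rewrite leNgt; apply/negP => uF.
have [qNy|qNy] := eqVneq (quantile u) -oo.
  by move: uF; rewrite qNy F0 ltNge u0.
have : nbhs (quantile u) [set z | u < cdf_of z].
  apply: (cF (quantile u) [set z | u < z]).
  by apply: open_nbhs_nbhs; split => //; exact: open_ereal_gt_ereal.
move=> /(nbhs_ereal_lt qNy)[z zq /= /ltW /quantile_le_of].
by rewrite leNgt zq.
Qed.

End Quantile.

(** * The randomised distribution transform *)

Section Transform.
Context d (T : measurableType d) (R : realType).
Variables (P : probability T R).
Local Notation F := (cdf_of P).
Local Notation G := (lcdf_of P).

(** Clipping leaves a uniform variable almost surely unchanged, and makes the bounds on the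
    transform hold everywhere. *)
Definition clipr (v : R) : R := Num.max 0%R (Num.min v 1%R).

Lemma clipr_itv v : (0 <= clipr v <= 1)%R.
Proof. by rewrite /clipr le_max lexx/= ge_max ge_min ler01 lexx orbT. Qed.

Lemma measurable_clipr : measurable_fun setT clipr.
Proof. by apply: measurable_maxr => //; exact: measurable_minr. Qed.

Definition randomized_cdf (X : T -> \bar R) (tv : T * measurableTypeR R) : \bar R :=
  G X (X tv.1) + (clipr tv.2)%:E * (F X (X tv.1) - G X (X tv.1)).

Let V : probability (measurableTypeR R) R := uniform_prob (@ltr01 R).

Lemma uniform_clipr (s : R) : (0 <= s <= 1)%R -> V [set v | clipr v <= s]%R = s%:E.
Proof.
move=> /andP[s0 s1].
rewrite /V /= /uniform_prob integral_uniform_pdf.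
rewrite (_ : _ `&` _ = `[0%R, s]%classic); last first.
  apply/seteqP; split => v /=; rewrite !in_itv/=.
    move=> [+ /andP[v0 v1]]; rewrite /clipr (min_idPl v1) (max_idPr v0).
    by rewrite v0.
  move=> /andP[v0 vs]; have v1 := le_trans vs s1.
  by rewrite /clipr (min_idPl v1) (max_idPr v0) v0 v1.
rewrite (eq_integral (fun=> 1)); last first.
  move=> v; rewrite inE/= in_itv/= => /andP[v0 vs].
  by rewrite /uniform_pdf v0 (le_trans vs s1)/= subr0 invr1.
rewrite integral_cst//= mul1e lebesgue_measure_itv/= lte_fin -EFinB subr0.
by case: ltP => // sle; congr EFin; apply/eqP; rewrite eq_le s0 sle.
Qed.

Variable X : T -> \bar R.
Hypothesis mX : measurable_fun setT X.
Local Notation U := (randomized_cdf X).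

Lemma measurable_randomized_cdf : measurable_fun setT U.
Proof.
have mX1 : measurable_fun setT (fun tv : T * measurableTypeR R => X tv.1).
  by apply: (measurableT_comp mX).
have mF : measurable_fun setT (fun tv : T * measurableTypeR R => F X (X tv.1)).
  apply: measurableT_comp mX1.
  exact/nondecreasing_emeasurable/cdf_of_nd.
have mG : measurable_fun setT (fun tv : T * measurableTypeR R => G X (X tv.1)).
  apply: measurableT_comp mX1.
  exact/nondecreasing_emeasurable/lcdf_of_nd.
apply: emeasurable_funD => //; apply: emeasurable_funM.
  apply: measurableT_comp => //.
  exact: (measurableT_comp measurable_clipr).
exact: emeasurable_funB.
Qed.

Lemma randomized_cdf_itv tv : G X (X tv.1) <= U tv <= F X (X tv.1).
Proof.
rewrite /randomized_cdf.
have := lcdf_of_le P mX (X tv.1); have /andP[] := clipr_itv tv.2.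
rewrite -(fineK (lcdf_of_fin P mX (X tv.1))) -(fineK (cdf_of_fin P mX (X tv.1))).
move: (fine _) (fine _) (clipr _) => h g c c0 c1.
rewrite -EFinB -EFinM -EFinD !lee_fin => gh.
by apply/andP; split; nra.
Qed.

(* The event [E] is squeezed between [U < u] and [U <= u], and has probability
   exactly [u]: the uniform variable splits the atom of [X] at the quantile in
   the proportion needed to reach [u]. *)
Lemma randomized_cdf_squeeze u : 0 <= u <= 1 ->
  exists E : set (T * measurableTypeR R),
  [/\ measurable E, (P \x V) E = u, [set tv | U tv < u] `<=` E &
      E `<=` [set tv | U tv <= u]].
Proof.
move=> /andP[u0 u1]; pose q := quantile P X u.
have Gq : G X q <= u by exact: lcdf_quantile.
have Fq : u <= F X q by rewrite -quantile_le.
(* The values of the uniform variable that keep the transform at most [u] on the atom [X = q]. *)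
pose W : set (measurableTypeR R) :=
  [set v | G X q + (clipr v)%:E * (F X q - G X q) <= u].
have mW : measurable W.
  rewrite -[X in measurable X]setTI; apply: emeasurable_fun_infty_c => //.
  apply: emeasurable_funD => //; apply: emeasurable_funM => //.
  by apply: measurableT_comp => //; exact: measurable_clipr.
have mlt := measurable_rv_lt mX q.
have meq : measurable [set t | X t = q].
  by have := mX measurableT (emeasurable_set1 q); rewrite setTI.
exists ([set t | X t < q] `*` setT `|` [set t | X t = q] `*` W).
have m1 : measurable ([set t | X t < q] `*` [set: measurableTypeR R]).
  exact: measurableX.
have m2 : measurable ([set t | X t = q] `*` W) by exact: measurableX.
split.
- exact: measurableU.
- transitivity (G X q + (F X q - G X q) * V W).
    rewrite -probability_rv_eq// -[X in X + _]mule1 -(probability_setT V).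
    apply: etrans (measureU _ m1 m2 _) _.
      apply/seteqP; split => // -[t v] /= [[tq _] [tE _]].
      by rewrite tE ltxx in tq.
    by congr (_ + _); exact: product_measure1E.
  have ufin : u \is a fin_num.
    by rewrite ge0_fin_numE// (le_lt_trans u1)// ltry.
  have Wfin : V W \is a fin_num by exact: fin_num_measure.
  (* Without an atom at [q], the value [u] is squeezed between F(q-) and F(q), which coincide. *)
  have [FG|FG] := eqVneq (F X q) (G X q).
    have -> : u = G X q by apply/eqP; rewrite eq_le Gq -FG Fq.
    by rewrite FG subee ?lcdf_of_fin// mul0e adde0.
  have gfin := lcdf_of_fin P mX q; have hfin := cdf_of_fin P mX q.
  pose g := fine (G X q); pose h := fine (F X q); pose r := fine u.
  have gr : (g <= r)%R by rewrite fine_le.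
  have rh : (r <= h)%R by rewrite fine_le.
  have hg : (0 < h - g)%R.
    rewrite subr_gt0 lt_neqAle (le_trans gr rh) andbT eq_sym.
    by apply: contraNneq FG => hg; rewrite -(fineK gfin) -(fineK hfin) -/g -/h hg.
  (* Solving the condition in [W] for [clipr v] gives this threshold, which lies in [0,1]. *)
  have -> : V W = ((r - g) / (h - g))%:E.
    rewrite -uniform_clipr; last first.
      rewrite ler_pdivrMr// mul1r lerD2r rh andbT.
      by rewrite divr_ge0// ?subr_ge0// ltW// -subr_gt0.
    congr (V _); apply/seteqP; split => v; rewrite /W /=;
      rewrite -(fineK gfin) -(fineK hfin) -(fineK ufin) -/g -/h -/r;
      by rewrite lee_fin ler_pdivlMr// lerBrDl.
  rewrite -(fineK gfin) -(fineK hfin) -(fineK ufin) -/g -/h -/r.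
  by rewrite -EFinB -EFinM -EFinD mulrCA divff ?gt_eqF// mulr1 addrC subrK.
- move=> [t v] /= Uu.
  (* Beyond the quantile, U >= F(X-) >= F(q) >= u contradicts U < u. *)
  have [tq|qt|tq] := ltgtP (X t) q; [by left|exfalso|right].
    have /andP[GU _] := randomized_cdf_itv (t, v).
    have := le_lt_trans (le_trans Fq (le_trans (cdf_of_le_lcdf P mX qt) GU)) Uu.
    by rewrite ltxx.
  by split => //=; rewrite /W/= -tq; exact: ltW.
- move=> [t v] /= [[/= tq _]|[/= tq]]; last by rewrite /W /randomized_cdf /= tq.
  have /andP[_ /le_trans] := randomized_cdf_itv (t, v); apply => /=.
  rewrite leNgt; apply/negP => /ltW/quantile_le_of.
  by rewrite leNgt tq.
Qed.

(** The squeeze at [u] bounds the probability from below; the squeeze at a level above [u] bounds it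
    from above. *)
Lemma randomized_cdf_uniform u : (P \x V) [set tv | U tv <= u] = clip01 u.
Proof.
have mU := measurable_randomized_cdf.
have mle := measurable_rv_le mU.
have U01 tv : 0 <= U tv <= 1.
  have /andP[GU UF] := randomized_cdf_itv tv.
  have /andP[_ F1] := cdf_of_itv P mX (X tv.1).
  by rewrite (le_trans _ GU) ?measure_ge0// (le_trans UF).
have [u0|u0] := ltP u 0.
  rewrite clip01_lt0// (_ : [set _ | _] = set0) ?measure0//.
  apply/seteqP; split => // tv /= Uu; have /andP[/le_lt_trans] := U01 tv.
  by move/(_ _ (le_lt_trans Uu u0)); rewrite ltxx.
have [u1|u1] := ltP 1 u.
  rewrite clip01_gt1// (_ : [set _ | _] = setT) ?probability_setT//.
  apply/seteqP; split => // tv _ /=; have /andP[_ /le_trans] := U01 tv.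
  by apply; exact: ltW.
rewrite clip01_id ?u0//; apply/eqP; rewrite eq_le; apply/andP; split; last first.
  have [|E [mE PE _ EU]] := @randomized_cdf_squeeze u; first by rewrite u0.
  by rewrite -[X in X <= _]PE; apply: le_measure; rewrite ?inE.
set p := (X in X <= _); rewrite leNgt; apply/negP => up.
have /andP[p0 p1] : 0 <= p <= 1 := cdf_of_itv (P \x V) mU u.
have pfin : p \is a fin_num by rewrite ge0_fin_numE// (le_lt_trans p1)// ltry.
have ufin : u \is a fin_num by rewrite ge0_fin_numE// (le_lt_trans u1)// ltry.
(* With [y] strictly between [u] and [p], the event of probability [y] contains [U <= u], whence
   [p <= y]. *)
pose y := ((fine u + fine p) / 2)%:E.
have upr : (fine u < fine p)%R by rewrite fine_lt.
have uy : u < y by rewrite -(fineK ufin) lte_fin; lra.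
have yp : y < p by rewrite -(fineK pfin) lte_fin; lra.
have [|E [mE Ey UE _]] := @randomized_cdf_squeeze y.
  by rewrite (le_trans u0 (ltW uy)) (le_trans (ltW yp) p1).
have : p <= (P \x V) E.
  apply: le_measure; rewrite ?inE// => tv /= Uu.
  by apply: UE => /=; exact: le_lt_trans uy.
by rewrite Ey leNgt yp.
Qed.

End Transform.

(** * Sklar's theorem over an arbitrary index set *)

Section Sklar.
Variables (I : Type) (R : realType).

Lemma copula_coord_le (C : probability (eRprod I R) R) i x :
  is_copula C -> C [set f | f i <= x] = clip01 x.
Proof.
move=> copC; rewrite -unif01_le.
by apply: (copC i [set y | y <= x]); exact: (measurable_rv_le (X := id)).
Qed.

Lemma exists_copula (mu : probability (eRprod I R) R) :
  exists C : probability (eRprod I R) R, is_copula C /\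
    forall (J : set I) (x : I -> \bar R), finite_set J ->
      cdfJ C J (fun j => cdf1 mu j (x j)) = cdfJ mu J x.
Proof.
pose X i (f : eRprod I R) := f i.
have mX i : measurable_fun setT (X i) by exact: measurable_proj.
pose V : probability (measurableTypeR R) R := uniform_prob (@ltr01 R).
pose U tv : eRprod I R := fun i => randomized_cdf mu (X i) tv.
have mU i : measurable_fun setT (fun tv => U tv i).
  exact: measurable_randomized_cdf.
have [C CE] := probability_image (mu \x V) (measurable_into_prod mU).
have Cle i x : C [set f | f i <= x] = clip01 x.
  by rewrite CE; exact: randomized_cdf_uniform.
exists C; split.
  by move=> i A mA; apply: (unif01_unique (measurable_proj i) (Cle i)).
move=> J x fJ; rewrite /cdfJ CE.
(* The event on the coordinate, lifted to the product space so that it can be compared with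
   [B j]. *)
pose A j := [set f : eRprod I R | f j <= x j] `*` [set: measurableTypeR R].
pose B j := [set tv | U tv j <= cdf1 mu j (x j)].
have mle j : measurable [set f : eRprod I R | f j <= x j].
  exact: measurable_coord_le.
transitivity ((mu \x V) (\bigcap_(j in J) B j)); first by [].
transitivity ((mu \x V) (cylinder J x `*` setT)).
  have -> : cylinder J x `*` setT = \bigcap_(j in J) A j.
    apply/seteqP; split => -[f v] /=.
      by move=> [fx _] j Jj; split => //; exact: fx.
    by move=> fx; split => // j /fx[].
  apply: measure_nested_bigcap => //.
  - by move=> j _; exact: (measurable_rv_le (mU j)).
  - by move=> j _; exact: measurableX.
  (* U_j <= F_j(f_j) <= F_j(x_j) on [A j]. *)
  - move=> j _; right => -[f v] [/= fx _].
    have /andP[_ /le_trans] := randomized_cdf_itv mu (mX j) (f, v).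
    by apply; exact: (cdf_of_nd mu (mX j)).
  - move=> j _; transitivity (clip01 (cdf1 mu j (x j))).
      exact: randomized_cdf_uniform.
    rewrite clip01_id; last exact: (cdf_of_itv mu (mX j)).
    apply: esym; apply: etrans (product_measure1E _ _ (mle j) measurableT) _.
    exact: etrans (congr1 (mule _) (probability_setT V)) (mule1 _).
have mcyl : measurable (cylinder J x).
  by rewrite cylinderE; exact: fin_bigcap_measurable.
apply: etrans (product_measure1E _ _ mcyl measurableT) _.
exact: etrans (congr1 (mule _) (probability_setT V)) (mule1 _).
Qed.

(** Rays at a level and at its clipped level are nested and equally likely under a uniform marginal.
    This reduces uniqueness to levels in [0,1]. *)
Lemma copula_cdf_clip (C : probability (eRprod I R) R) (J : set I) u :
  is_copula C -> finite_set J ->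
  cdfJ C J u = cdfJ C J (fun j => clip01 (u j)).
Proof.
move=> copC fJ; apply: measure_nested_bigcap => //.
- by move=> j _; exact: measurable_coord_le.
- by move=> j _; exact: measurable_coord_le.
- move=> j _; have [uc|/ltW cu] := leP (u j) (clip01 (u j)).
    by left => f /= /le_trans; exact.
  by right => f /= /le_trans; exact.
- move=> j _; apply: etrans (copula_coord_le _ _ copC) _.
  apply: esym; apply: etrans (copula_coord_le _ _ copC) _.
  by rewrite clip01_id ?clip01_itv.
Qed.

Lemma copula_unique (mu C1 C2 : probability (eRprod I R) R) :
  (forall i : I, continuous (cdf1 mu i) /\ cdf1 mu i -oo = 0) ->
  is_copula C1 -> is_copula C2 ->
  (forall (J : set I) (x : I -> \bar R), finite_set J ->
     cdfJ C1 J (fun j => cdf1 mu j (x j)) = cdfJ mu J x) ->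
  (forall (J : set I) (x : I -> \bar R), finite_set J ->
     cdfJ C2 J (fun j => cdf1 mu j (x j)) = cdfJ mu J x) ->
  forall A : set (eRprod I R), measurable A -> C1 A = C2 A.
Proof.
move=> cmu cop1 cop2 C1mu C2mu; apply: eq_cdfJ => J u fJ.
rewrite !(copula_cdf_clip u)//.
(* Continuity makes F_i take the clipped level exactly at this quantile, so the identity fixes the
   copula on every cylinder. *)
pose q i := quantile mu (fun f : eRprod I R => f i) (clip01 (u i)).
have -> : (fun j => clip01 (u j)) = fun j => cdf1 mu j (q j).
  apply/funext => j; have [cj j0] := cmu j.
  by rewrite -[LHS](cdf_quantile (measurable_proj j) cj j0 (clip01_itv _)).
by rewrite C1mu ?C2mu.
Qed.

Lemma exists_probability_copula (C : probability (eRprod I R) R)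
    (nu : I -> probability (\bar R) R) : is_copula C ->
  exists mu : probability (eRprod I R) R,
    forall (J : set I) (x : I -> \bar R), finite_set J ->
      cdfJ C J (fun j => cdfR (nu j) (x j)) = cdfJ mu J x.
Proof.
move=> copC.
have mid : measurable_fun setT (id : \bar R -> \bar R) by [].
(* [nu i] is viewed as the law of the identity map. *)
pose q i := quantile (nu i) id.
have mq i : measurable_fun setT (q i) by exact: measurable_quantile.
have cdfRE i x : cdfR (nu i) x = cdf_of (nu i) id x.
  by congr (nu i _); apply/seteqP; split => y /=; rewrite in_itv/= leNye.
pose Q (f : eRprod I R) : eRprod I R := fun i => q i (f i).
have mQ i : measurable_fun setT (fun f => Q f i).
  exact: measurableT_comp (mq i) (measurable_proj i).
have [mu muE] := probability_image C (measurable_into_prod mQ).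
exists mu => J x fJ; rewrite /cdfJ muE.
transitivity (C (\bigcap_(j in J) [set f | f j <= cdfR (nu j) (x j)])) => //.
transitivity (C (\bigcap_(j in J) [set f | Q f j <= x j])) => //.
apply: measure_nested_bigcap => //.
- by move=> j _; exact: measurable_coord_le.
- by move=> j _; exact: (measurable_rv_le (mQ j)).
(* The reverse inclusion can fail at levels above 1, so equality of probabilities is checked
   separately. *)
- by move=> j _; left => f /=; rewrite cdfRE; exact: quantile_le_of.
- move=> j _.
  transitivity (unif01 [set u | u <= cdfR (nu j) (x j)]).
    by apply: copC; exact: (measurable_rv_le mid).
  transitivity (unif01 [set u | q j u <= x j]); last first.
    by apply/esym/copC; exact: (measurable_rv_le (mq j)).
  (* Only levels in [0,1] count here, and for them the two conditions are equivalent. *)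
  congr (lebesgue_measure _); apply/seteqP; split => r /= [rx r01]; split => //.
    by rewrite /q quantile_le_of// -cdfRE.
  move: r01 rx; rewrite in_itv/= => /andP[_ r1].
  by rewrite /q quantile_le// cdfRE.
Qed.

End Sklar.

Theorem mainTheorem1 (I : Type) (R : realType) :
  (* (a) existence *)
  (forall mu : probability (eRprod I R) R,
     (exists C : probability (eRprod I R) R,
        is_copula C /\
        forall (J : set I) (x : I -> \bar R), finite_set J ->
          cdfJ C J (fun j => cdf1 mu j (x j)) = cdfJ mu J x)
     /\
     (* (a) uniqueness under continuous marginal CDFs *)
     ((forall i : I, continuous (cdf1 mu i) /\ cdf1 mu i -oo = 0) ->
      forall C1 C2 : probability (eRprod I R) R,
        is_copula C1 -> is_copula C2 ->
        (forall (J : set I) (x : I -> \bar R), finite_set J ->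
           cdfJ C1 J (fun j => cdf1 mu j (x j)) = cdfJ mu J x) ->
        (forall (J : set I) (x : I -> \bar R), finite_set J ->
           cdfJ C2 J (fun j => cdf1 mu j (x j)) = cdfJ mu J x) ->
        forall A : set (eRprod I R), measurable A -> C1 A = C2 A))
  /\
  (* (b) *)
  (forall (C : probability (eRprod I R) R) (nu : I -> probability (\bar R) R),
     is_copula C ->
     (exists mu : probability (eRprod I R) R,
        forall (J : set I) (x : I -> \bar R), finite_set J ->
          cdfJ C J (fun j => cdfR (nu j) (x j)) = cdfJ mu J x)
     /\
     (forall mu1 mu2 : probability (eRprod I R) R,
        (forall (J : set I) (x : I -> \bar R), finite_set J ->
           cdfJ C J (fun j => cdfR (nu j) (x j)) = cdfJ mu1 J x) ->
        (forall (J : set I) (x : I -> \bar R), finite_set J ->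
           cdfJ C J (fun j => cdfR (nu j) (x j)) = cdfJ mu2 J x) ->
        forall A : set (eRprod I R), measurable A -> mu1 A = mu2 A)).
Proof.
split=> [mu|C nu copC]; split.
- exact: exists_copula.
- by move=> cmu C1 C2; exact: copula_unique.
- exact: exists_probability_copula.
(* The copula side of the identity depends on [C] and [nu] alone, so both measures agree on
   cylinders. *)
- move=> mu1 mu2 C1 C2; apply: eq_cdfJ => J x fJ.
  by rewrite -C1 ?C2.
Qed.
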